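(* Let $x_1,\dots,x_m\in\mathbb{R}^n$ and let $P_1,\dots,P_m\in\mathbb{R}^{n\times n}$ be symmetric positive definite. Let the objective function $f$ be the trace function $f(P)=\operatorname{tr}(P)$ or the logdet function $f(P)=\log\det(P)$. Consider the SDP relaxation (S): minimize $f(P_0)$ over symmetric positive definite $P_0\in\mathbb{R}^{n\times n}$, $\tilde x_0\in\mathbb{R}^n$ and $\lambda_1,\dots,\lambda_m$ subject to $\lambda_i\ge 0$, $i=1,\dots,m$, and $$\begin{bmatrix} P_0^{-1}-\sum_{i=1}^m\lambda_iP_i^{-1} & -\tilde x_0+\sum_{i=1}^m\lambda_iP_i^{-1}x_i & 0\\ \left(-\tilde x_0+\sum_{i=1}^m\lambda_iP_i^{-1}x_i\right)^T & -1-\sum_{i=1}^m\lambda_i(x_i^TP_i^{-1}x_i-1) & \tilde x_0^T\\ 0&\tilde x_0&-P_0^{-1}\end{bmatrix}\preceq 0,$$ where $\tilde x_0=P_0^{-1}x_0$ and $x_0$ is the center of the associated ellipsoid. Then (S) can be equivalently decoupled to the problem (D): minimize $$f\left(\Big(\sum_{i=1}^m\lambda_iP_i^{-1}\Big)^{-1}\right)$$ over $\lambda_1,\dots,\lambda_m$ subject to $\lambda_i\ge0$, $i=1,\dots,m$, and $$\begin{bmatrix}1-\sum_{i=1}^m\lambda_i+\sum_{i=1}^m\lambda_ix_i^TP_i^{-1}x_i & \sum_{i=1}^m\lambda_ix_i^TP_i^{-1}\\ \sum_{i=1}^m\lambda_iP_i^{-1}x_i&\sum_{i=1}^m\lambda_iP_i^{-1}\end{bmatrix}\succeq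 0.$$ If (D) is feasible, then there exists an optimal solution of (S). In this case, calling $\lambda_i^*$ the optimal values of the variables $\lambda_i$, $i=1,\dots,m$, in (D), the optimal shape matrix $P_0$ and center $x_0$ of (S) satisfy $$P_0^{-1}=\sum_{i=1}^m\lambda_i^*P_i^{-1},\qquad x_0=P_0\sum_{i=1}^m\lambda_i^*P_i^{-1}x_i.$$
   Context: $A\preceq B$ (resp. $A\succeq B$) denotes the Loewner order on real symmetric matrices. The ellipsoid with center $c$ and symmetric positive definite shape matrix $P$ is $\{x\in\mathbb{R}^n:(x-c)^TP^{-1}(x-c)\le1\}$. Problem (S) is a relaxation of the problem of finding the ellipsoid, with center $x_0$ and shape matrix $P_0$, of minimum size $f(P_0)$ containing $\bigcap_{i=1}^m\{x:(x-x_i)^TP_i^{-1}(x-x_i)\le1\}$.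
   Formalization: Existence of an optimal solution of (S) is stated assuming also that the intersection of the ellipsoids has nonempty interior (it fails otherwise, e.g. disjoint intervals); feasibility in (D) includes invertibility of the sum of λ_i P_i^{-1}, so that the objective is defined. *)

(* Defs.v *)
From HB Require Import structures.
From mathcomp Require Import all_boot all_order all_algebra.
From mathcomp Require Import all_classical all_reals all_analysis.

Set Implicit Arguments.
Unset Strict Implicit.
Unset Printing Implicit Defensive.

Import Order.TTheory GRing.Theory Num.Theory.
Import numFieldNormedType.Exports.

Local Open Scope classical_set_scope.
Local Open Scope ring_scope.

Definition qform (R : realType) (n : nat) (A : 'M[R]_n) (v : 'cV[R]_n) : R :=
  (v^T *m A *m v) 0 0.

Definition spd (R : realType) (n : nat) (A : 'M[R]_n) : Prop :=
  A^T = A /\ forall v : 'cV[R]_n, v != 0 -> 0 < qform A v.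

Definition loewner_le (R : realType) (n : nat) (A B : 'M[R]_n) : Prop :=
  [/\ A^T = A, B^T = B & forall v : 'cV[R]_n, 0 <= qform (B - A) v].

Definition ellipsoid (R : realType) (n : nat) (c : 'cV[R]_n) (P : 'M[R]_n) :
    set 'cV[R]_n :=
  [set x | qform (invmx P) (x - c) <= 1].

Definition trace_obj (R : realType) (n : nat) (P : 'M[R]_n) : R := \tr P.

Definition logdet_obj (R : realType) (n : nat) (P : 'M[R]_n) : R :=
  ln (\det P).

Definition minimizer (R : realType) (T : Type) (F : set T) (g : T -> R)
    (t : T) : Prop :=
  F t /\ forall s, F s -> g t <= g s.

Section Problems.
Context (R : realType) (m n : nat).
Variables (x : 'I_m -> 'cV[R]_n) (P : 'I_m -> 'M[R]_n).

Definition wshape (lam : 'I_m -> R) : 'M[R]_n := \sum_(i < m) lam i *: invmx (P i).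

Definition wcenter (lam : 'I_m -> R) : 'cV[R]_n :=
  \sum_(i < m) lam i *: (invmx (P i) *m x i).

(* Decision variables (P_0, \tilde x_0, lambda). *)
Definition Svar : Type := ('M[R]_n * 'cV[R]_n * ('I_m -> R))%type.

Definition Smatrix (P0 : 'M[R]_n) (xt0 : 'cV[R]_n) (lam : 'I_m -> R) :
    'M[R]_((n + 1) + n) :=
  let b : 'cV[R]_n := - xt0 + wcenter lam in
  let d : 'M[R]_1 :=
    (- 1)%:M - \sum_(i < m) lam i *: ((x i)^T *m invmx (P i) *m x i - 1%:M) in
  block_mx
    (block_mx (invmx P0 - wshape lam) b
              b^T                     d)
    (col_mx 0 xt0^T)
    (row_mx 0 xt0) (- invmx P0).

Definition Sfeasible : set Svar :=
  [set s | let: (P0, xt0, lam) := s in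
     [/\ spd P0, forall i, 0 <= lam i & loewner_le (Smatrix P0 xt0 lam) 0]].

Definition Sobj (f : 'M[R]_n -> R) (s : Svar) : R := f s.1.1.

Definition Dmatrix (lam : 'I_m -> R) : 'M[R]_(1 + n) :=
  block_mx
    ((1 - \sum_(i < m) lam i)%:M
       + \sum_(i < m) lam i *: ((x i)^T *m invmx (P i) *m x i))
    (\sum_(i < m) lam i *: ((x i)^T *m invmx (P i)))
    (wcenter lam) (wshape lam).

(* The invertibility condition is the domain of the objective
   f ((\sum_i lambda_i P_i^-1)^-1).  It has to be explicit because [invmx] is
   total; e.g. lambda = 0 always satisfies the other two constraints. *)
Definition Dfeasible : set ('I_m -> R) :=
  [set lam | [/\ forall i, 0 <= lam i, wshape lam \in unitmx
               & loewner_le 0 (Dmatrix lam)]].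

Definition Dobj (f : 'M[R]_n -> R) (lam : 'I_m -> R) : R :=
  f (invmx (wshape lam)).

End Problems.

(* Main.v *)
(* On vectors [(u, t, w)] with [w = u] the quadratic form of the (S) matrix no
   longer involves [P_0] and [\tilde x_0], and is minus the form of the (D)
   matrix at [(t, -u)]; with [t = w = 0] it says
   [P_0^-1 <= W := \sum_i lambda_i P_i^-1].  Conversely a (D)-feasible [lambda]
   gives the (S)-feasible point [P_0 = W^-1],
   [\tilde x_0 = q := \sum_i lambda_i P_i^-1 x_i].  As trace and logdet are strictly
   increasing for the Loewner order, (S) forces [P_0 = W^-1] at the optimum.
   Strict convexity of [W |-> f (W^-1)] makes [W] the same for all minimizers of
   (D), and strict convexity of the Schur complement condition does it for [q].
   A point interior to all the ellipsoids bounds the [lambda_i], so that existence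
   follows by compactness. *)

Require Import Defs.
From HB Require Import structures.
From mathcomp Require Import all_boot all_order all_fingroup all_algebra.
From mathcomp Require Import all_classical all_reals all_analysis.
From mathcomp Require Import ring lra.

Import Order.TTheory GRing.Theory Num.Theory.
Import numFieldNormedType.Exports.

Local Open Scope classical_set_scope.
Local Open Scope ring_scope.

(** * Dot product and quadratic forms *)

Definition dot {R : realType} {n : nat} (u v : 'cV[R]_n) : R := (u^T *m v) 0 0.

Section Dot.
Context {R : realType} {n : nat}.
Implicit Types (u v w : 'cV[R]_n) (A B : 'M[R]_n) (a : R).

Lemma dotE u v : dot u v = \sum_i u i 0 * v i 0.
Proof. by rewrite /dot mxE; apply: eq_bigr => i _; rewrite mxE. Qed.

Lemma dotC u v : dot u v = dot v u.
Proof. by rewrite !dotE; apply: eq_bigr => i _; rewrite mulrC. Qed.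

Lemma dotDr u v w : dot u (v + w) = dot u v + dot u w.
Proof. by rewrite /dot mulmxDr mxE. Qed.

Lemma dotDl u v w : dot (v + w) u = dot v u + dot w u.
Proof. by rewrite dotC dotDr !(dotC u). Qed.

Lemma dotZr a u v : dot u (a *: v) = a * dot u v.
Proof. by rewrite /dot -scalemxAr mxE. Qed.

Lemma dotZl a u v : dot (a *: u) v = a * dot u v.
Proof. by rewrite dotC dotZr dotC. Qed.

Lemma dot0r u : dot u 0 = 0.
Proof. by rewrite /dot mulmx0 mxE. Qed.

Lemma dotNr u v : dot u (- v) = - dot u v.
Proof. by rewrite -scaleN1r dotZr mulN1r. Qed.

Lemma dotNl u v : dot (- u) v = - dot u v.
Proof. by rewrite dotC dotNr dotC. Qed.

Lemma dot_mulmx p (A : 'M[R]_(p, n)) u (v : 'cV_p) :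
  dot v (A *m u) = dot (A^T *m v) u.
Proof. by rewrite /dot trmx_mul trmxK mulmxA. Qed.

Lemma dot_sym A u v : A^T = A -> dot v (A *m u) = dot u (A *m v).
Proof. by move=> sA; rewrite dot_mulmx sA dotC. Qed.

Lemma dot_sumr (I : finType) (F : I -> 'cV[R]_n) u :
  dot u (\sum_i F i) = \sum_i dot u (F i).
Proof. by rewrite /dot mulmx_sumr summxE. Qed.

Lemma dot_eq0 u : (dot u u == 0) = (u == 0).
Proof.
apply/idP/eqP => [|->]; last by rewrite dot0r.
rewrite dotE psumr_eq0 => [/allP u0|i _]; last by rewrite -expr2 sqr_ge0.
apply/matrixP => i j; rewrite ord1 mxE; apply/eqP.
by have := u0 i (mem_index_enum i); rewrite /= mulf_eq0 orbb.
Qed.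

Lemma dot_delta i v : dot (delta_mx i 0) v = v i 0.
Proof. by rewrite /dot trmx_delta -rowE mxE. Qed.

Lemma qformE A v : qform A v = dot v (A *m v).
Proof. by rewrite /qform /dot mulmxA. Qed.

Lemma qformDm A B v : qform (A + B) v = qform A v + qform B v.
Proof. by rewrite !qformE mulmxDl dotDr. Qed.

Lemma qformNm A v : qform (- A) v = - qform A v.
Proof. by rewrite !qformE mulNmx dotNr. Qed.

Lemma qformZm a A v : qform (a *: A) v = a * qform A v.
Proof. by rewrite !qformE -scalemxAl dotZr. Qed.

Lemma qformD A u v : A^T = A ->
  qform A (u + v) = qform A u + 2 * dot u (A *m v) + qform A v.
Proof.
move=> sA; rewrite !qformE mulmxDr !(dotDl, dotDr) (dot_sym _ _ v) //; ring.
Qed.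

Lemma qformZ a A v : qform A (a *: v) = a ^+ 2 * qform A v.
Proof. by rewrite !qformE -scalemxAr dotZl dotZr expr2 mulrA. Qed.

Lemma qformN A v : qform A (- v) = qform A v.
Proof. by rewrite !qformE mulmxN dotNl dotNr opprK. Qed.

Lemma qform0 A : qform A 0 = 0.
Proof. by rewrite qformE mulmx0 dot0r. Qed.

Lemma qform0m v : qform 0 v = 0.
Proof. by rewrite qformE mul0mx dot0r. Qed.

Lemma qform_delta A i : qform A (delta_mx i 0) = A i i.
Proof. by rewrite qformE dot_delta -colE mxE. Qed.

Lemma dot_delta_mulmx A i j : dot (delta_mx i 0) (A *m delta_mx j 0) = A i j.
Proof. by rewrite dot_delta -colE mxE. Qed.

End Dot.

Lemma dot_col_mx {R : realType} {p q} (a c : 'cV[R]_p) (b d : 'cV[R]_q) :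
  dot (col_mx a b) (col_mx c d) = dot a c + dot b d.
Proof. by rewrite /dot tr_col_mx mul_row_col mxE. Qed.

Lemma dot_scalar {R : realType} (s t : R) :
  dot (s%:M : 'cV_1) t%:M = s * t.
Proof. by rewrite dotE big_ord1 !mxE eqxx. Qed.

(** * Definite matrices, their inverses and the Loewner order *)

Section Definite.
Context {R : realType} {n : nat}.
Implicit Types (A B : 'M[R]_n) (u v : 'cV[R]_n).

Lemma loewner_leP A B : A^T = A -> B^T = B ->
  loewner_le A B <-> forall v, qform A v <= qform B v.
Proof.
move=> sA sB; split=> [[_ _ h] v|h]; first by rewrite -subr_ge0 -qformNm -qformDm.
by split=> // v; rewrite qformDm qformNm subr_ge0.
Qed.

Lemma loewner_le_qform A B v : loewner_le A B -> qform A v <= qform B v.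
Proof. by move=> h; case: (h) => sA sB _; move/loewner_leP: h; apply. Qed.

Lemma spd_ge0 A v : spd A -> 0 <= qform A v.
Proof.
move=> [_ pA]; have [->|v0] := eqVneq v 0; first by rewrite qform0.
exact: ltW (pA v v0).
Qed.

Lemma spd_eq0 A v : spd A -> qform A v = 0 -> v = 0.
Proof.
move=> [_ pA] q0; apply/eqP; apply: contraT => /pA; by rewrite q0 ltxx.
Qed.

Lemma spd_unit A : spd A -> A \in unitmx.
Proof.
move=> sA; rewrite unitmxE unitfE; apply/negP => /det0P[v v0 vA].
have := v0; rewrite -(inj_eq trmx_inj) trmx0 => /(sA.2 v^T).
by rewrite /qform trmxK vA mul0mx mxE ltxx.
Qed.

Lemma spd_inv A : spd A -> spd (invmx A).
Proof.
move=> sA; have uA := spd_unit _ sA.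
have sAi : (invmx A)^T = invmx A by rewrite trmx_inv sA.1.
split=> // v v0.
have -> : qform (invmx A) v = qform A (invmx A *m v).
  by rewrite !qformE mulmxA mulmxV // mul1mx dotC.
apply: sA.2; apply: contra_neq v0 => h.
by rewrite -[v]mul1mx -(mulmxV uA) -mulmxA h mulmx0.
Qed.

(** For small [s] of sign opposite to [a] the linear term would win. Both [psd_ker] and the
    identification of the center rest on this perturbation. *)
Lemma affine_quadratic_ge0 (a b : R) :
  (forall s, 0 <= 2 * s * a + s ^+ 2 * b) -> a = 0.
Proof.
move=> h; have b0 : 0 < b ^+ 2 + 1 by rewrite ltr_wpDl // sqr_ge0.
(* This [s] works for either sign of [b]: with [c = b ^+ 2 + 1] the value is
   [- (a ^+ 2 * ((2 * c - b) / c ^+ 2))], and [2 * c - b > 0]. *)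
have := h (- a / (b ^+ 2 + 1)).
set c := b ^+ 2 + 1 in b0 *.
have -> : 2 * (- a / c) * a + (- a / c) ^+ 2 * b = - (a ^+ 2 * ((2 * c - b) / c ^+ 2)).
  by field; rewrite gt_eqF.
rewrite oppr_ge0 pmulr_lle0; last first.
  by rewrite divr_gt0 ?exprn_gt0 // /c; nra.
by rewrite le_eqVlt ltNge sqr_ge0 orbF sqrf_eq0 => /eqP.
Qed.

(** A zero of the form is a minimum point, and the first-order term along [A *m v] is twice the
    squared norm of [A *m v]. *)
Lemma psd_ker A v : A^T = A -> (forall w, 0 <= qform A w) ->
  qform A v = 0 -> A *m v = 0.
Proof.
move=> sA pA v0; apply/eqP; rewrite -dot_eq0; apply/eqP.
apply: (@affine_quadratic_ge0 _ (qform A (A *m v))) => s.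
have := pA (v + s *: (A *m v)).
rewrite qformD // v0 qformZ -scalemxAr dotZr dot_sym // add0r.
by rewrite mulrA.
Qed.

Lemma psd_unit_spd A : A^T = A -> (forall w, 0 <= qform A w) ->
  A \in unitmx -> spd A.
Proof.
move=> sA pA uA; split=> // v v0; rewrite lt_neqAle pA andbT eq_sym.
apply: contra_neq v0 => /(psd_ker _ _ sA pA) h.
by rewrite -[v]mul1mx -(mulVmx uA) -mulmxA h mulmx0.
Qed.

Lemma spd_le A B : spd A -> B^T = B -> (forall v, qform A v <= qform B v) ->
  spd B.
Proof. by move=> sA sB AB; split=> // v v0; apply: lt_le_trans (sA.2 v v0) _. Qed.

(* Completing the square: [qform (invmx A) v] is the maximum over [u] of
   [2 * dot u v - qform A u]. *)
Lemma qform_inv A u v : spd A ->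
  qform (invmx A) v = 2 * dot u v - qform A u + qform A (u - invmx A *m v).
Proof.
move=> sA; have uA := spd_unit _ sA; rewrite qformD ?sA.1 // qformN.
rewrite mulmxN dotNr mulmxA mulmxV // mul1mx.
have -> : qform A (invmx A *m v) = qform (invmx A) v.
  by rewrite !qformE mulmxA mulmxV // mul1mx dotC.
ring.
Qed.

Lemma qform_inv_ge A u v : spd A -> 2 * dot u v - qform A u <= qform (invmx A) v.
Proof. by move=> sA; rewrite (qform_inv _ u v sA) lerDl spd_ge0. Qed.

Lemma qform_inv_max A v : spd A ->
  qform (invmx A) v = 2 * dot (invmx A *m v) v - qform A (invmx A *m v).
Proof. by move=> sA; rewrite (qform_inv _ (invmx A *m v) v sA) subrr qform0 addr0. Qed.

(** The inverse form is a maximum of expressions that decrease with the matrix, so the maximizer for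
    [B] already gives the bound for [A]. *)
Lemma qform_inv_anti A B v : spd A -> spd B ->
  (forall u, qform A u <= qform B u) -> qform (invmx B) v <= qform (invmx A) v.
Proof.
move=> sA sB AB; rewrite (qform_inv_max _ _ sB).
by apply: le_trans (qform_inv_ge _ (invmx B *m v) v sA); rewrite lerD2l lerN2.
Qed.

Lemma qform_inj A B : A^T = A -> B^T = B ->
  (forall v, qform A v = qform B v) -> A = B.
Proof.
move=> sA sB AB; apply/eqP; rewrite -subr_eq0; apply/eqP.
have z : forall v, qform (A - B) v = 0.
  by move=> v; rewrite qformDm qformNm AB subrr.
apply/matrixP => i j; rewrite -dot_delta_mulmx psd_ker //.
  by rewrite dot0r mxE.
- by rewrite linearB /= sA sB.
- by move=> w; rewrite z.
Qed.

End Definite.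

(** * The trace, and strict convexity of matrix inversion *)

Section Monotonicity.
Context {R : realType} {n : nat}.
Implicit Types A B : 'M[R]_n.

Lemma invmx_inj A B : invmx A = invmx B -> A = B.
Proof. by move=> AB; rewrite -[A]invmxK AB invmxK. Qed.

Lemma psd_trace_eq0 A : A^T = A -> (forall v, 0 <= qform A v) ->
  \tr A = 0 -> A = 0.
Proof.
move=> sA pA /eqP; rewrite /mxtrace psumr_eq0 => [/allP d0|i _]; last first.
  by rewrite -qform_delta.
apply/matrixP => i j; rewrite -dot_delta_mulmx psd_ker //.
  by rewrite dot0r mxE.
by apply/eqP; rewrite qform_delta; apply: d0; rewrite mem_index_enum.
Qed.

Lemma trace_mono A B : (forall v, qform A v <= qform B v) -> \tr A <= \tr B.
Proof. by move=> AB; apply: ler_sum => i _; rewrite -!qform_delta. Qed.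

Lemma trace_mono_eq A B : A^T = A -> B^T = B ->
  (forall v, qform A v <= qform B v) -> \tr A = \tr B -> A = B.
Proof.
move=> sA sB AB tAB; apply/esym/eqP; rewrite -subr_eq0; apply/eqP.
apply: psd_trace_eq0; first by rewrite linearB /= sA sB.
  by move=> v; rewrite qformDm qformNm subr_ge0.
by rewrite linearB /= tAB subrr.
Qed.

(** Testing the form at the sum and difference of two basis vectors bounds the entry by the mean of
    two diagonal entries. *)
Lemma psd_entry_le_trace A i j : A^T = A -> (forall v, 0 <= qform A v) ->
  `|A i j| <= \tr A.
Proof.
move=> sA pA.
have d_ge0 k : 0 <= A k k by rewrite -qform_delta.
have d_le k : A k k <= \tr A.
  by rewrite /mxtrace (bigD1 k) //= lerDl sumr_ge0.
have := pA (delta_mx i 0 + delta_mx j 0); have := pA (delta_mx i 0 - delta_mx j 0).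
rewrite !qformD // qformN mulmxN dotNr !qform_delta !dot_delta_mulmx.
by have := d_le i; have := d_le j; rewrite ler_norml; lra.
Qed.

Lemma spd_mean A B : spd A -> spd B -> spd (2^-1 *: (A + B)).
Proof.
move=> sA sB; split; first by rewrite linearZ linearD /= sA.1 sB.1.
by move=> v v0; rewrite qformZm qformDm mulr_gt0 // addr_gt0 //; [apply: sA.2|apply: sB.2].
Qed.

(** The convexity gap of inversion: [u] is the maximizer in the variational formula for the mean,
    and the formulas for [A] and [B] taken at this same [u] leave two squares. *)
Lemma inv_mean_id A B v : spd A -> spd B ->
  let u := invmx (2^-1 *: (A + B)) *m v in
  qform (2^-1 *: (invmx A + invmx B)) v = qform (invmx (2^-1 *: (A + B))) v
    + 2^-1 * (qform A (u - invmx A *m v) + qform B (u - invmx B *m v)).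
Proof.
move=> sA sB u; rewrite (qform_inv_max _ _ (spd_mean _ _ sA sB)) -/u.
rewrite !qformZm !qformDm (qform_inv A u) // (qform_inv B u) //; lra.
Qed.

Lemma inv_mean_le A B v : spd A -> spd B ->
  qform (invmx (2^-1 *: (A + B))) v <= qform (2^-1 *: (invmx A + invmx B)) v.
Proof.
move=> sA sB; rewrite inv_mean_id // lerDl mulr_ge0 ?invr_ge0 // addr_ge0 //;
  exact: spd_ge0.
Qed.

(** In the equality case both squares of [inv_mean_id] vanish, so the inverse of the mean and
    [invmx A] agree on every [v]. *)
Lemma inv_mean_eq A B : spd A -> spd B ->
  invmx (2^-1 *: (A + B)) = 2^-1 *: (invmx A + invmx B) -> A = B.
Proof.
move=> sA sB e.
suff : invmx (2^-1 *: (A + B)) = invmx A.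
  move/invmx_inj => h; have : A + B = A + A.
    by rewrite -[A + B]scale1r -(@mulfV _ (2 : R)) // -scalerA h scaler_nat mulr2n.
  by move/addrI.
have h (v : 'cV[R]_n) : invmx (2^-1 *: (A + B)) *m v = invmx A *m v.
  apply/eqP; rewrite -subr_eq0; apply/eqP; apply: (spd_eq0 A) => //.
  have := inv_mean_id A B v sA sB; rewrite /= -e.
  set a := qform A _; set b := qform B _.
  have : 0 <= a by apply: spd_ge0.
  have : 0 <= b by apply: spd_ge0.
  lra.
by apply/matrixP => i j; rewrite -!dot_delta_mulmx h.
Qed.

End Monotonicity.

(** * Schur complements, and determinants of definite matrices *)

Section Schur.
Context {R : realType} {n : nat}.
Implicit Types (M : 'M[R]_(1 + n)) (v : 'cV[R]_n).

Definition schur M : 'M[R]_n :=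
  drsubmx M - (M 0 0)^-1 *: (dlsubmx M *m (dlsubmx M)^T).

Lemma ulsubmx11 M : ulsubmx M = (M 0 0)%:M.
Proof.
rewrite [LHS]mx11_scalar; congr (_%:M); rewrite !mxE; congr (M _ _); exact: val_inj.
Qed.

Lemma sym_blocks M : M^T = M ->
  (ursubmx M)^T = dlsubmx M /\ (drsubmx M)^T = drsubmx M.
Proof. by move=> sM; rewrite trmx_ursub trmx_drsub sM. Qed.

Lemma qform_block M (t : R) v : M^T = M ->
  qform M (col_mx t%:M v) =
  t ^+ 2 * M 0 0 + 2 * t * dot (dlsubmx M) v + qform (drsubmx M) v.
Proof.
move=> sM; have [sur _] := sym_blocks M sM.
rewrite qformE -{1}[M]submxK mul_block_col dot_col_mx ulsubmx11.
rewrite -scalar_mxM -[dlsubmx M *m _]/(dlsubmx M *m t%:M) mul_mx_scalar.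
rewrite !dotDr dotZr -qformE dot_scalar.
have -> : dot t%:M (ursubmx M *m v) = t * dot (dlsubmx M) v.
  by rewrite dot_mulmx sur mul_mx_scalar dotZl.
rewrite (dotC v); ring.
Qed.

Lemma schur_sym M : M^T = M -> (schur M)^T = schur M.
Proof.
move=> sM; have [_ sdr] := sym_blocks M sM.
by rewrite /schur linearB linearZ /= trmx_mul trmxK sdr.
Qed.

Lemma qform_schur M v : M^T = M -> qform (schur M) v =
  qform (drsubmx M) v - (M 0 0)^-1 * dot (dlsubmx M) v ^+ 2.
Proof.
move=> sM; rewrite /schur qformDm qformNm qformZm; congr (_ - _ * _).
rewrite /qform mulmxA -mulmxA mxE big_ord1.
rewrite -[X in X * _]/(dot v (dlsubmx M)) -[X in _ * X]/(dot (dlsubmx M) v).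
by rewrite dotC expr2.
Qed.

(** Completing the square in [t]: for [M 0 0 > 0] the Schur form is the minimum over [t], which is
    how it inherits monotonicity and definiteness. *)
Lemma qform_schur_min M (t : R) v : M^T = M -> M 0 0 != 0 ->
  qform M (col_mx t%:M v) = qform (schur M) v
   + M 0 0 * (t + (M 0 0)^-1 * dot (dlsubmx M) v) ^+ 2.
Proof. by move=> sM m0; rewrite qform_block // qform_schur //; field. Qed.

Lemma spd_corner M : spd M -> 0 < M 0 0.
Proof.
move=> sM; rewrite -qform_delta; apply: sM.2.
by apply/negP => /eqP/matrixP/(_ 0 0)/eqP; rewrite !mxE eqxx oner_eq0.
Qed.

Lemma schur_mono M N v : spd M -> spd N -> (forall w, qform M w <= qform N w) ->
  qform (schur M) v <= qform (schur N) v.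
Proof.
move=> sM sN MN; have m0 := spd_corner M sM; have n0 := spd_corner N sN.
(* This [t] is optimal for [N] and only a competitor for [M]. *)
have := MN (col_mx (- ((N 0 0)^-1 * dot (dlsubmx N) v))%:M v).
rewrite !qform_schur_min ?sM.1 ?sN.1 ?gt_eqF // addNr expr0n mulr0 addr0.
by apply: le_trans; rewrite lerDl mulr_ge0 ?sqr_ge0 // ltW.
Qed.

Lemma spd_schur M : spd M -> spd (schur M).
Proof.
move=> sM; split; first exact: schur_sym sM.1.
move=> v v0; have m0 := spd_corner M sM.
have := sM.2 (col_mx (- ((M 0 0)^-1 * dot (dlsubmx M) v))%:M v).
rewrite qform_schur_min ?sM.1 ?gt_eqF // addNr expr0n mulr0 addr0; apply.
apply: contra_neq v0 => h.
by rewrite -[v](col_mxKd (- ((M 0 0)^-1 * dot (dlsubmx M) v))%:M) h linear0.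
Qed.

Lemma det_schur M : spd M -> \det M = M 0 0 * \det (schur M).
Proof.
move=> sM; have m0 := spd_corner M sM; have [sur _] := sym_blocks M sM.1.
have {1}-> : M = block_mx 1%:M 0 ((M 0 0)^-1 *: dlsubmx M) 1%:M
    *m block_mx (M 0 0)%:M (dlsubmx M)^T 0 (schur M).
  rewrite mulmx_block !mul1mx !mul0mx !addr0 mul_mx_scalar scalerA.
  rewrite mulfV ?gt_eqF // scale1r -scalemxAl addrC subrK -ulsubmx11.
  by rewrite -[in LHS](submxK M) -[X in block_mx _ X](trmxK (ursubmx M)) sur.
by rewrite det_mulmx det_lblock det_ublock !det1 !mul1r det_scalar1.
Qed.

End Schur.

Lemma spd_det_gt0 {R : realType} n (A : 'M[R]_n) : spd A -> 0 < \det A.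
Proof.
elim: n A => [|n IH] A sA; first by rewrite det_mx00.
rewrite (@det_schur _ n A) // mulr_gt0 //; first exact: (@spd_corner _ n A).
by apply/IH/spd_schur.
Qed.

Lemma det_mono {R : realType} n (A B : 'M[R]_n) : spd A -> spd B ->
  (forall v, qform A v <= qform B v) -> \det A <= \det B.
Proof.
elim: n A B => [|n IH] A B sA sB AB; first by rewrite !det_mx00.
rewrite (@det_schur _ n A) // (@det_schur _ n B) // ler_pM //.
- exact/ltW/(@spd_corner _ n A).
- exact/ltW/spd_det_gt0/spd_schur.
- by have := AB (delta_mx 0 0); rewrite !qform_delta.
- apply: IH; [exact: spd_schur|exact: spd_schur|].
  by move=> v; apply: schur_mono.
Qed.

(** Products of ordered positive factors agree only if the factors do. Equal corners, Schur
    complements and first columns then determine the matrix. *)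
Lemma det_mono_eq {R : realType} n (A B : 'M[R]_n) : spd A -> spd B ->
  (forall v, qform A v <= qform B v) -> \det A = \det B -> A = B.
Proof.
elim: n A B => [|n IH] A B sA sB AB.
  by move=> _; apply/matrixP => - [].
rewrite (@det_schur _ n A) // (@det_schur _ n B) // => dAB.
have a0 := @spd_corner _ n A sA; have b0 := @spd_corner _ n B sB.
have sSA := @spd_schur _ n A sA; have sSB := @spd_schur _ n B sB.
have SAB : forall v, qform (@schur _ n A) v <= qform (@schur _ n B) v.
  by move=> v; apply: schur_mono.
have ab : A 0 0 <= B 0 0 by have := AB (delta_mx 0 0); rewrite !qform_delta.
have dS := det_mono _ _ _ sSA sSB SAB.
have da := spd_det_gt0 _ _ sSA.
have abE : A 0 0 = B 0 0 by nra.
have dSE : \det (@schur _ n A) = \det (@schur _ n B) by nra.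
have SE := IH _ _ sSA sSB SAB dSE.
have sD : (B - A)^T = B - A by rewrite linearB /= sA.1 sB.1.
(* [B - A] is positive semidefinite with zero corner, so the first basis vector lies in its kernel:
   the first columns agree. *)
have D00 : (B - A) *m (delta_mx 0 0 : 'cV_n.+1) = 0.
  apply: psd_ker => //; first by move=> v; rewrite qformDm qformNm subr_ge0.
  by rewrite qform_delta !mxE abE subrr.
have dl : @dlsubmx _ 1 n 1 n A = @dlsubmx _ 1 n 1 n B.
  apply/eqP; rewrite eq_sym -subr_eq0 -linearB; apply/eqP/matrixP => i j.
  have := congr1 (fun M : 'cV_n.+1 => M (rshift 1 i) 0) D00.
  rewrite -colE !mxE ord1 => <-; congr (B _ _ - A _ _); exact: val_inj.
apply: qform_inj sA.1 sB.1 _ => v; rewrite -[v](@vsubmxK _ 1 n).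
rewrite [usubmx _]mx11_scalar !(@qform_schur_min _ n) ?sA.1 ?sB.1 ?gt_eqF //.
by rewrite SE abE dl.
Qed.

(** * Strict monotonicity and convexity of the two objectives *)

Section Objectives.
Context {R : realType} {n : nat}.
Implicit Types (f : 'M[R]_n -> R) (A B : 'M[R]_n).

Definition loewner_increasing f := forall A B, spd A -> spd B ->
  (forall v, qform A v <= qform B v) -> f A <= f B /\ (f A = f B -> A = B).

(** Strict convexity of [A |-> f (invmx A)] at midpoints, the form in which it is applied to two
    minimizers. *)
Definition inv_midconvex f := forall A B, spd A -> spd B ->
  f (invmx (2^-1 *: (A + B))) <= 2^-1 * (f (invmx A) + f (invmx B)) /\
  (f (invmx (2^-1 *: (A + B))) = 2^-1 * (f (invmx A) + f (invmx B)) -> A = B).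

Lemma trace_increasing : loewner_increasing (@trace_obj R n).
Proof.
move=> A B sA sB AB; split; first exact: trace_mono.
exact: trace_mono_eq sA.1 sB.1 AB.
Qed.

Lemma trace_midconvex : inv_midconvex (@trace_obj R n).
Proof.
move=> A B sA sB.
have [iA iB] := (spd_inv _ sA, spd_inv _ sB).
have E : 2^-1 * (\tr (invmx A) + \tr (invmx B)) =
    \tr (2^-1 *: (invmx A + invmx B)) by rewrite linearZ linearD.
rewrite /trace_obj E; have le v := inv_mean_le A B v sA sB.
have [h1 h2] := trace_increasing _ _ (spd_inv _ (spd_mean _ _ sA sB))
  (spd_mean _ _ iA iB) le.
by split=> // /h2; apply: inv_mean_eq.
Qed.

Lemma logdet_increasing : loewner_increasing (@logdet_obj R n).
Proof.
move=> A B sA sB AB; have [dA dB] := (spd_det_gt0 _ _ sA, spd_det_gt0 _ _ sB).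
split; first by rewrite /logdet_obj ler_ln ?posrE // det_mono.
by move/ln_inj => h; apply: det_mono_eq => //; apply: h.
Qed.

Lemma logdet_inv A : spd A -> logdet_obj (invmx A) = - logdet_obj A.
Proof. by move=> sA; rewrite /logdet_obj det_inv lnV // posrE spd_det_gt0. Qed.

Lemma logdet_midconvex : inv_midconvex (@logdet_obj R n).
Proof.
move=> A B sA sB; have sM := spd_mean _ _ sA sB.
have [iA iB] := (spd_inv _ sA, spd_inv _ sB); have iM := spd_mean _ _ iA iB.
have le v := inv_mean_le A B v sA sB.
(* With [M] the mean of [A] and [B], the mean of the inverses is [invmx A *m M *m invmx B].
   Monotonicity of logdet then says that twice the logdet of [M] is at least the sum of those of [A]
   and [B]. *)
have E : 2^-1 *: (invmx A + invmx B) =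
    invmx A *m (2^-1 *: (A + B)) *m invmx B.
  rewrite -scalemxAr -scalemxAl mulmxDr mulmxDl mulVmx ?spd_unit // mul1mx.
  by rewrite -mulmxA mulmxV ?spd_unit // mulmx1 addrC.
have dE : logdet_obj (2^-1 *: (invmx A + invmx B)) =
    - logdet_obj A + logdet_obj (2^-1 *: (A + B)) - logdet_obj B.
  rewrite -!logdet_inv // /logdet_obj E !det_mulmx !lnM ?posrE ?mulr_gt0 //;
  exact: spd_det_gt0.
have [h1 h2] := logdet_increasing _ _ (spd_inv _ sM) iM le.
rewrite !logdet_inv // in h1 h2 *; rewrite dE in h1 h2; split; first lra.
by move=> e; apply: inv_mean_eq => //; apply: h2; lra.
Qed.

End Objectives.


(** * Continuity of the objectives and determinant bounds on sublevel sets *)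

Section Continuity.
Context {R : realType}.

Lemma continuous_lincomb (T : topologicalType) m (h : 'I_m -> T -> R) (a : 'I_m -> R) :
  (forall i, continuous (h i)) -> continuous (fun z => \sum_i h i z * a i).
Proof.
move=> ch; apply: (@continuous_big R _ _ 0 xpredT (@add_continuous R)) => i _ z.
by apply: cvgM; [exact: ch|exact: cvg_cst].
Qed.

Lemma continuous_det (T : topologicalType) n (A : T -> 'M[R]_n) :
  (forall i j, continuous (fun z => A z i j)) -> continuous (fun z => \det (A z)).
Proof.
move=> cA; apply: (@continuous_big R _ _ 0 xpredT (@add_continuous R)) => s _ z.
apply: cvgM; first exact: cvg_cst.
apply: (@continuous_big R _ _ 1 xpredT (@mul_continuous R)) => i _; exact: cA.
Qed.

Lemma continuous_trace_adj (T : topologicalType) n (A : T -> 'M[R]_n) :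
  (forall i j, continuous (fun z => A z i j)) ->
  continuous (fun z => \tr (\adj (A z))).
Proof.
move=> cA; apply: (@continuous_big R _ _ 0 xpredT (@add_continuous R)) => i _.
rewrite (_ : (fun z => \adj (A z) i i) =
  fun z => (-1) ^+ (i + i) * \det (row' i (col' i (A z)))); last first.
  by apply/funext => z; rewrite mxE.
move=> z; apply: cvgM; first exact: cvg_cst.
apply: (continuous_det _ _ (fun z => row' i (col' i (A z)))) => j k.
rewrite (_ : (fun z => row' i (col' i (A z)) j k) =
  fun z => A z (lift i j) (lift i k)); last first.
  by apply/funext => w; rewrite !mxE.
exact: cA.
Qed.

(* What the Weierstrass argument needs of [f]: a continuous expression for
   [f (invmx A)], and sublevel sets on which [\det (invmx A)] stays away from 0. *)
Definition inv_continuous (n : nat) (f : 'M[R]_n -> R) := exists2 g : 'M[R]_n -> R,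
  forall A, spd A -> f (invmx A) = g A &
  forall (T : topologicalType) (A : T -> 'M[R]_n) z,
    (forall i j, continuous (fun y => A y i j)) -> 0 < \det (A z) ->
    {for z, continuous (g \o A)}.

Definition det_bounded (n : nat) (f : 'M[R]_n -> R) :=
  forall c, exists M, forall A, spd A -> f A <= c -> \det A <= M.

Lemma trace_inv_continuous n : inv_continuous n (@trace_obj R n).
Proof.
(* Cramer's formula reduces continuity to polynomials in the entries and one division. *)
exists (fun A => (\det A)^-1 * \tr (\adj A)) => [A /spd_unit uA|T A z cA dA].
  by rewrite /trace_obj /invmx uA linearZ.
apply: cvgM; last exact: (continuous_trace_adj _ _ A).
by apply: cvgV; [rewrite gt_eqF|exact: (continuous_det _ _ A)].
Qed.

Lemma trace_det_bounded n : det_bounded n (@trace_obj R n).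
Proof.
(* Leibniz expansion, with every entry bounded by the trace and hence by [c]. *)
move=> c; exists (\sum_(s : 'S_n) \prod_(i < n) c) => A sA trA.
apply: le_trans (ler_norm _) _; apply: le_trans (ler_norm_sum _ _ _) _.
apply: ler_sum => s _; rewrite normrM normrX normrN1 expr1n mul1r normr_prod.
apply: ler_prod => i _; rewrite normr_ge0 /=.
apply: le_trans trA; apply: psd_entry_le_trace; first exact: sA.1.
by move=> v; exact: spd_ge0.
Qed.

Lemma logdet_inv_continuous n : inv_continuous n (@logdet_obj R n).
Proof.
exists (fun A => - ln (\det A)) => [A|T A z cA dA]; first exact: logdet_inv.
apply: cvgN; apply: (@continuous_comp _ _ _ (fun y => \det (A y)) (@ln R)).
  exact: (continuous_det _ _ A).
exact: continuous_ln.
Qed.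

Lemma logdet_det_bounded n : det_bounded n (@logdet_obj R n).
Proof.
move=> c; exists (expR c) => A sA le_c.
by rewrite -ler_ln ?posrE ?expR_gt0 ?spd_det_gt0 // expRK.
Qed.

Lemma closed_ge_continuous (T : topologicalType) (g : T -> R) (a : R) :
  continuous g -> closed [set z | a <= g z].
Proof. by move=> /continuous_closedP cg; exact: (cg _ (@closed_ge _ a)). Qed.

Lemma closed_forall (T : topologicalType) I (F : I -> set T) :
  (forall i, closed (F i)) -> closed [set z | forall i, F i z].
Proof.
move=> cF; rewrite (_ : [set z | _] = \bigcap_i F i); first by apply: closed_bigI => i _.
by apply/seteqP; split=> z h i; [move=> _|]; exact: h.
Qed.

End Continuity.

(** An interior point can be pushed slightly away from the center without leaving the ellipsoid;
    this multiplies the form by a factor above 1, so a positive value must have been below 1. *)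
Lemma interior_ellipsoid {R : realType} {n} (c y : 'cV[R]_n) (Q : 'M[R]_n) :
  (ellipsoid c Q)° y -> qform (invmx Q) (y - c) < 1.
Proof.
move=> Ey.
have : (fun s : R => y + s *: (y - c)) s @[s --> (0 : R)] --> y.
  rewrite -[X in _ --> X](_ : y + 0 *: (y - c) = y); last by rewrite scale0r addr0.
  apply: cvgD; first exact: cvg_cst.
  by apply: cvgZr_tmp; exact: cvg_id.
move/(_ _ Ey) => /nbhs_ballP[e /= e0 /(_ (e / 2))].
have e2 : 0 < e / 2 by rewrite divr_gt0.
have he : ball (0 : R) e (e / 2).
  by rewrite /ball /= sub0r normrN gtr0_norm //; lra.
move/(_ he); rewrite /= /ellipsoid /=.
have -> : y + e / 2 *: (y - c) - c = (1 + e / 2) *: (y - c).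
  by rewrite scalerDl scale1r addrAC.
rewrite qformZ; have [q0|q0] := lerP (qform (invmx Q) (y - c)) 0 => h; first lra.
nra.
Qed.

(** * Quadratic forms of the constraint matrices of (S) and (D) *)

Section Problems.
Context {R : realType} {m n : nat}.
Context (x : 'I_m -> 'cV[R]_n) (P : 'I_m -> 'M[R]_n).
Context (hP : forall i, spd (P i)).
Implicit Types (lam : 'I_m -> R) (u v w xt : 'cV[R]_n) (t : R) (Q : 'M[R]_n).

(** The corner entry of the (D) matrix, and minus the middle diagonal entry of the (S) matrix. *)
Definition wslack lam : R :=
  1 - \sum_i lam i + \sum_i lam i * qform (invmx (P i)) (x i).

Let sPi i : (invmx (P i))^T = invmx (P i).
Proof. exact: (spd_inv _ (hP i)).1. Qed.

Lemma wshape_sym lam : (wshape P lam)^T = wshape P lam.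
Proof. by rewrite linear_sum; apply: eq_bigr => i _; rewrite linearZ /= sPi. Qed.

Lemma wcenter_tr lam :
  (\sum_i lam i *: ((x i)^T *m invmx (P i)))^T = wcenter x P lam.
Proof.
rewrite linear_sum; apply: eq_bigr => i _.
by rewrite linearZ /= trmx_mul trmxK sPi.
Qed.

Lemma Dmatrix_sym lam : (Dmatrix x P lam)^T = Dmatrix x P lam.
Proof.
rewrite /Dmatrix tr_block_mx wcenter_tr -wcenter_tr trmxK wshape_sym.
by congr block_mx; rewrite [X in X^T]mx11_scalar tr_scalar_mx -mx11_scalar.
Qed.

Lemma Dmatrix00 lam : Dmatrix x P lam 0 0 = wslack lam.
Proof.
have -> : Dmatrix x P lam 0 0 = ulsubmx (Dmatrix x P lam) 0 0.
  by rewrite ulsubmx11 [RHS]mxE eqxx.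
rewrite block_mxKul mxE [X in X + _]mxE eqxx mulr1n summxE; congr (_ + _).
by apply: eq_bigr => i _; rewrite mxE.
Qed.

Definition Dform lam t v : R :=
  t ^+ 2 * wslack lam + 2 * t * dot (wcenter x P lam) v + qform (wshape P lam) v.

Lemma qform_Dmatrix lam t v : qform (Dmatrix x P lam) (col_mx t%:M v) = Dform lam t v.
Proof.
rewrite (@qform_block _ n) ?Dmatrix_sym // Dmatrix00.
by rewrite block_mxKdl block_mxKdr.
Qed.

Lemma DfeasibleE lam : Dfeasible x P lam <->
  [/\ forall i, 0 <= lam i, wshape P lam \in unitmx & forall t v, 0 <= Dform lam t v].
Proof.
split=> -[lam0 uW h]; split=> //.
  move=> t v; by have := loewner_le_qform _ _ (col_mx t%:M v) h; rewrite qform_Dmatrix qform0m.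
apply/loewner_leP; rewrite ?trmx0 ?Dmatrix_sym // => v.
rewrite -[v](@vsubmxK _ 1 n) [usubmx _]mx11_scalar qform_Dmatrix.
by rewrite qform0m.
Qed.

Lemma Dfeasible_spd lam : Dfeasible x P lam -> spd (wshape P lam).
Proof.
move=> /DfeasibleE[_ uW h]; apply: psd_unit_spd => //; first exact: wshape_sym.
by move=> v; have := h 0 v; rewrite /Dform expr0n mulr0 !mul0r !add0r.
Qed.

Definition Sform Q xt lam u t w : R :=
  qform (invmx Q) u - qform (wshape P lam) u
  + 2 * t * (dot (wcenter x P lam) u - dot xt u) - t ^+ 2 * wslack lam
  + 2 * t * dot xt w - qform (invmx Q) w.

Let Sd lam : (- 1)%:M - \sum_i lam i *: ((x i)^T *m invmx (P i) *m x i - 1%:M)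
  = (- wslack lam)%:M :> 'M[R]_1.
Proof.
rewrite [LHS]mx11_scalar; congr _%:M.
rewrite mxE [X in X + _]mxE eqxx mulr1n mxE summxE /wslack.
rewrite (eq_bigr (fun i => lam i * qform (invmx (P i)) (x i) - lam i)); last first.
  by move=> i _; rewrite !mxE eqxx /qform mxE mulrBr mulr1.
by rewrite sumrB; ring.
Qed.

Lemma Smatrix_sym Q xt lam : Q^T = Q ->
  (Smatrix x P Q xt lam)^T = Smatrix x P Q xt lam.
Proof.
move=> sQ; have sQi : (invmx Q)^T = invmx Q by rewrite trmx_inv sQ.
rewrite /Smatrix Sd !tr_block_mx tr_col_mx tr_row_mx !trmx0 !trmxK.
by rewrite tr_scalar_mx linearB /= linearN /= sQi wshape_sym.
Qed.

Lemma qform_Smatrix Q xt lam u t w :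
  qform (Smatrix x P Q xt lam) (col_mx (col_mx u t%:M) w) = Sform Q xt lam u t w.
Proof.
rewrite /Smatrix Sd qformE !mul_block_col mul_col_mx mul_row_col !dot_col_mx.
rewrite add_col_mx dot_col_mx !mul0mx mul_mx_scalar !addr0 add0r -scalar_mxM.
rewrite mul_mx_scalar !mulNmx !(dotDr, dotNr, dotZr) mulmxBl !(dotDr, dotNr) -!qformE.
rewrite dot_scalar !(dot_mulmx _ _ _ t%:M) !trmxK !mul_mx_scalar !dotZl.
rewrite dotDl dotNl !(dotC u) (dotC w) /Sform; ring.
Qed.

Lemma SfeasibleE Q xt lam : Sfeasible x P (Q, xt, lam) <->
  [/\ spd Q, forall i, 0 <= lam i & forall u t w, Sform Q xt lam u t w <= 0].
Proof.
split=> -[sP lam0 h]; split=> //.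
  move=> u t w; have := loewner_le_qform _ _ (col_mx (col_mx u t%:M) w) h.
  by rewrite qform_Smatrix qform0m.
apply/loewner_leP => [||v]; [exact: Smatrix_sym sP.1|exact: trmx0|].
rewrite -[v]vsubmxK -[usubmx v]vsubmxK [dsubmx (usubmx v)]mx11_scalar qform_Smatrix.
by rewrite qform0m.
Qed.

(* Restricting the (S) form to [w = u] cancels both [Q] and [xt] and leaves
   the (D) form. *)
Lemma Sfeasible_D Q xt lam : Sfeasible x P (Q, xt, lam) ->
  Dfeasible x P lam /\ (forall v, qform (invmx Q) v <= qform (wshape P lam) v).
Proof.
move=> /SfeasibleE[sP lam0 h].
have le v : qform (invmx Q) v <= qform (wshape P lam) v.
  by have := h v 0 0; rewrite /Sform qform0 expr0n mulr0 !mul0r; lra.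
split=> //; apply/DfeasibleE; split=> // [|t v].
  exact/spd_unit/(spd_le _ _ (spd_inv _ sP) (wshape_sym lam) le).
have := h (- v) t (- v); rewrite /Sform /Dform !qformN !dotNr; lra.
Qed.

(** At this point all terms in [u] cancel, and the (S) form is minus the (D) form at [(t, - w)]. *)
Lemma Dfeasible_S lam : Dfeasible x P lam ->
  Sfeasible x P (invmx (wshape P lam), wcenter x P lam, lam).
Proof.
move=> hD; have sW := Dfeasible_spd _ hD; move/DfeasibleE: hD => [lam0 uW h].
apply/SfeasibleE; split=> // [|u t w]; first exact: spd_inv.
have := h t (- w); rewrite /Sform /Dform invmxK qformN dotNr; lra.
Qed.

(** With this shape matrix the quadratic terms in [u] cancel, so [u] enters only linearly, through
    its product with [t]; a nonzero coefficient [q - xt] would break the sign. *)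
Lemma Sfeasible_center xt lam :
  Sfeasible x P (invmx (wshape P lam), xt, lam) -> xt = wcenter x P lam.
Proof.
move=> /SfeasibleE[_ _]; rewrite /Sform invmxK => h.
apply/esym/eqP; rewrite -subr_eq0 -dot_eq0; apply/eqP.
set q := wcenter x P lam in h *.
apply/oppr_inj; rewrite oppr0; apply: (affine_quadratic_ge0 _ (wslack lam)) => s.
have := h (q - xt) s 0; rewrite qform0 dot0r dotDl dotNl; lra.
Qed.

(** * Comparison of the objectives of (S) and (D) *)

Section Objective.
Context {f : 'M[R]_n -> R} (f_incr : loewner_increasing f).

Lemma Dobj_le_Sobj Q xt lam : Sfeasible x P (Q, xt, lam) ->
  Dobj P f lam <= f Q /\ (Dobj P f lam = f Q -> Q = invmx (wshape P lam)).
Proof.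
move=> hS; have [hD le] := Sfeasible_D _ _ _ hS; have sW := Dfeasible_spd _ hD.
have [sP _ _] := hS.
have := f_incr _ _ (spd_inv _ sW) sP; case=> [v|h1 h2].
  (* Writing [Q] as a double inverse lets antitonicity turn [invmx Q <= W] into [invmx W <= Q]. *)
  by rewrite -[X in _ <= qform X _]invmxK; apply: qform_inv_anti => //; exact: spd_inv.
by split=> // /h2.
Qed.

Lemma minimizer_SD Q xt lam :
  minimizer (Sfeasible x P) (@Sobj R m n f) (Q, xt, lam) <->
  [/\ minimizer (Dfeasible x P) (Dobj P f) lam,
      Q = invmx (wshape P lam) & xt = wcenter x P lam].
Proof.
split=> [[hS minS]|[[hD minD] -> ->]].
  have [hD _] := Sfeasible_D _ _ _ hS.
  have [le eqP0] := Dobj_le_Sobj _ _ _ hS.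
  have EP : Q = invmx (wshape P lam).
    by apply/eqP0/le_anti; rewrite le; apply: minS (Dfeasible_S _ hD).
  split=> //; last by apply: Sfeasible_center; rewrite -EP.
  split=> // mu /Dfeasible_S/minS; rewrite /Sobj /= EP; exact.
split; first exact: Dfeasible_S.
move=> [[Q1 xt1] mu] hS; have [hD1 _] := Sfeasible_D _ _ _ hS.
exact: le_trans (minD _ hD1) (Dobj_le_Sobj _ _ _ hS).1.
Qed.

Lemma ereal_inf_SD :
  ereal_inf [set (Sobj f s)%:E | s in Sfeasible x P] =
  ereal_inf [set (Dobj P f lam)%:E | lam in Dfeasible x P].
Proof.
apply/le_anti/andP; split; apply: le_ereal_inf_tmp.
- move=> _ [lam hD <-]; apply: ereal_inf_lbound.
  by exists (invmx (wshape P lam), wcenter x P lam, lam) => //; exact: Dfeasible_S.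
- move=> _ [[[Q xt] lam] hS <-]; have [hD _] := Sfeasible_D _ _ _ hS.
  apply: (@le_trans _ _ (Dobj P f lam)%:E).
    by apply: ereal_inf_lbound; exists lam.
  by rewrite lee_fin; exact: (Dobj_le_Sobj _ _ _ hS).1.
Qed.

End Objective.

(** Regrouped by ellipsoid: affine in [lam], and at [t = 1], [v = - y] each weight multiplies the
    constraint function of its ellipsoid at [y]. *)
Lemma DformE lam t v : Dform lam t v =
  t ^+ 2 + \sum_i lam i * (qform (invmx (P i)) (t *: x i + v) - t ^+ 2).
Proof.
rewrite /Dform /wslack (dotC (wcenter x P lam)) dot_sumr [qform (wshape P lam) v]qformE.
rewrite /wshape mulmx_suml dot_sumr.
rewrite [in RHS](eq_bigr (fun i => t ^+ 2 * (lam i * qform (invmx (P i)) (x i))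
  - t ^+ 2 * lam i + 2 * t * dot v (lam i *: (invmx (P i) *m x i))
  + dot v ((lam i *: invmx (P i)) *m v))).
  by rewrite !big_split /= sumrN -!mulr_sumr; ring.
move=> i _; rewrite qformD // qformZ -scalemxAl !dotZr dotZl (dot_sym _ v) // -qformE.
ring.
Qed.

Lemma wshape_mean lam mu :
  wshape P (fun i => 2^-1 * (lam i + mu i)) = 2^-1 *: (wshape P lam + wshape P mu).
Proof.
rewrite /wshape -big_split scaler_sumr; apply: eq_bigr => i _ /=.
by rewrite -scalerDl scalerA.
Qed.

Lemma Dform_mean lam mu t v : Dform (fun i => 2^-1 * (lam i + mu i)) t v =
  2^-1 * (Dform lam t v + Dform mu t v).
Proof.
rewrite !DformE addrACA -big_split mulrDr mulr_sumr; congr (_ + _); first by field.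
by apply: eq_bigr => i _ /=; ring.
Qed.

Lemma wshape_scale lam a : wshape P (fun i => a * lam i) = a *: wshape P lam.
Proof. by rewrite /wshape scaler_sumr; apply: eq_bigr => i _; rewrite scalerA. Qed.

Lemma Dform_scale lam a t v :
  Dform (fun i => a * lam i) t v = a * Dform lam t v - (a - 1) * t ^+ 2.
Proof.
rewrite !DformE mulrDr mulr_sumr.
under eq_bigr => i _ do rewrite -mulrA.
ring.
Qed.

Lemma Dfeasible_mean lam mu : Dfeasible x P lam -> Dfeasible x P mu ->
  Dfeasible x P (fun i => 2^-1 * (lam i + mu i)).
Proof.
move=> hl hm; have sM := spd_mean _ _ (Dfeasible_spd _ hl) (Dfeasible_spd _ hm).
move/DfeasibleE: hl => [l0 _ hl]; move/DfeasibleE: hm => [m0 _ hm].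
apply/DfeasibleE; split.
- by move=> i; rewrite mulr_ge0 // addr_ge0.
- by rewrite wshape_mean spd_unit.
- by move=> t v; rewrite Dform_mean mulr_ge0 // addr_ge0.
Qed.

(** Minimizing the (D) form at [t = 1] over [v], with minimum at minus [invmx W *m q], gives the
    Schur complement condition. *)
Lemma wslack_ge lam : Dfeasible x P lam ->
  qform (invmx (wshape P lam)) (wcenter x P lam) <= wslack lam.
Proof.
move=> hD; have sW := Dfeasible_spd _ hD; move/DfeasibleE: hD => [_ _ h].
have := h 1 (- (invmx (wshape P lam) *m wcenter x P lam)).
rewrite /Dform qformN dotNr (dotC (wcenter _ _ _)) (qform_inv_max _ _ sW); lra.
Qed.

(** * Uniqueness of the weighted shape and center *)

Section Uniqueness.
Context {f : 'M[R]_n -> R}.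
Context (f_incr : loewner_increasing f) (f_mid : inv_midconvex f).

Lemma minimizer_wshape_uniq lam mu :
  minimizer (Dfeasible x P) (Dobj P f) lam ->
  minimizer (Dfeasible x P) (Dobj P f) mu -> wshape P lam = wshape P mu.
Proof.
move=> [hl minl] [hm minm].
have [h1 h2] := f_mid _ _ (Dfeasible_spd _ hl) (Dfeasible_spd _ hm).
have := minl _ (Dfeasible_mean _ _ hl hm); have := minm _ (Dfeasible_mean _ _ hl hm).
have := minl _ hm; have := minm _ hl.
rewrite /Dobj wshape_mean in h1 h2 * => ? ? ? ?; apply: h2; lra.
Qed.

(* If the centers differed, the constraint of (D) would have positive slack
   [e] at the midpoint, so that the weights could be enlarged by the factor
   [1 + e], decreasing the objective. *)
Lemma minimizer_wcenter_uniq lam mu :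
  minimizer (Dfeasible x P) (Dobj P f) lam ->
  minimizer (Dfeasible x P) (Dobj P f) mu -> wcenter x P lam = wcenter x P mu.
Proof.
move=> ml mm; have W := minimizer_wshape_uniq _ _ ml mm.
have [hl minl] := ml; have [hm _] := mm.
apply: contrapT => /eqP; rewrite -subr_eq0 => q0.
have sW := Dfeasible_spd _ hl; have sWi := spd_inv _ sW.
have wl := wslack_ge _ hl; have wm := wslack_ge _ hm; rewrite -W in wm.
set Wl := wshape P lam in W sW sWi wl wm.
set ql := wcenter x P lam in wl q0; set qm := wcenter x P mu in wm q0.
(* By the parallelogram law for the form of [invmx Wl], this is what the Schur complement condition
   gains at the midpoint. *)
have pos := sWi.2 _ q0; set e := 4^-1 * qform (invmx Wl) (ql - qm).
have e0 : 0 < e by rewrite mulr_gt0.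
have wW : wshape P (fun i => 2^-1 * (lam i + mu i)) = Wl.
  by rewrite wshape_mean -W -mulr2n -(scaler_nat 2 Wl) scalerA mulVf // scale1r.
set nu := (fun i => (1 + e) * (2^-1 * (lam i + mu i))).
have nuW : wshape P nu = (1 + e) *: Wl by rewrite wshape_scale wW.
have sN : spd (wshape P nu).
  rewrite nuW; split; first by rewrite linearZ /= sW.1.
  by move=> v v0; rewrite qformZm mulr_gt0 ?sW.2 // addr_gt0.
have slack t v : t ^+ 2 * e <= Dform (fun i => 2^-1 * (lam i + mu i)) t v.
  rewrite Dform_mean /Dform -/Wl -W -/Wl -/ql -/qm.
  (* The variational bound at [- v] absorbs the cross term of the midpoint form. *)
  have := qform_inv_ge Wl (- v) ((t / 2) *: (ql + qm)) sW.
  rewrite qformN qformZ dotZr !dotNl dotDr !(dotC v).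
  have t2 := sqr_ge0 t.
  have := ler_wpM2l t2 wl; have := ler_wpM2l t2 wm.
  have -> : qform (invmx Wl) (ql + qm) =
    2 * qform (invmx Wl) ql + 2 * qform (invmx Wl) qm - 4 * e.
    by rewrite /e !qformD ?sWi.1 // qformN mulmxN dotNr; field.
  nra.
have hN : Dfeasible x P nu.
  have [[l0 _ _] [m0 _ _]] := (hl, hm).
  apply/DfeasibleE; split; [|exact: spd_unit|].
  - by move=> i; rewrite mulr_ge0 ?mulr_ge0 ?addr_ge0 // ltW.
  - move=> t v; rewrite Dform_scale.
    (* Scaling by [1 + e] costs [e * t ^+ 2], while the slack contributes [(1 + e) * e * t ^+ 2]. *)
    have := slack t v; have := sqr_ge0 t; nra.
have [h1 h2] := f_incr _ _ (spd_inv _ sN) sWi (fun v => qform_inv_anti _ _ v sW sN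
  (fun u => ltac:(rewrite nuW qformZm ler_peMl ?lerDl ?(ltW e0) //; exact: spd_ge0))).
(* Minimality excludes a decrease, so strict monotonicity would force [(1 + e) *: Wl = Wl], which
   fails on the nonzero vector [ql - qm]. *)
have : f (invmx (wshape P nu)) = f (invmx Wl) by apply/le_anti; rewrite h1 minl.
move/h2/invmx_inj; rewrite nuW => WW.
have := sW.2 _ q0; have : qform ((1 + e) *: Wl) (ql - qm) = qform Wl (ql - qm) by rewrite WW.
rewrite qformZm; nra.
Qed.

End Uniqueness.

(** * Existence of a minimizer of (D) *)

Section Existence.
Context {f : 'M[R]_n -> R}.
Context (f_cont : inv_continuous n f) (f_bnd : det_bounded n f).

(** In the (D) form at [(1, - y)] the other ellipsoids contribute nonpositive terms, so the [i]-th
    negative term cannot exceed 1 in size. *)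
Lemma weight_le lam y i : qform (invmx (P i)) (x i - y) < 1 ->
  (forall j, qform (invmx (P j)) (x j - y) < 1) -> Dfeasible x P lam ->
  lam i <= (1 - qform (invmx (P i)) (x i - y))^-1.
Proof.
move=> yi y1 /DfeasibleE[lam0 _ /(_ 1 (- y))]; rewrite DformE expr1n.
under eq_bigr => j _ do rewrite scale1r.
rewrite (bigD1 i) //= => h.
have : \sum_(j < m | j != i) lam j * (qform (invmx (P j)) (x j - y) - 1) <= 0.
  by apply: sumr_le0 => j _; rewrite mulr_ge0_le0 // subr_le0 ltW.
rewrite -[_^-1]mul1r ler_pdivlMr ?subr_gt0 //; lra.
Qed.

Lemma Dminimizer_exists :
  (\bigcap_i ellipsoid (x i) (P i))° !=set0 -> Dfeasible x P !=set0 ->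
  exists lam, minimizer (Dfeasible x P) (Dobj P f) lam.
Proof.
move=> [y Ey] [lam0 h0].
have y1 i : qform (invmx (P i)) (x i - y) < 1.
  rewrite -opprB qformN; apply: interior_ellipsoid.
  by apply: filterS Ey => z; apply.
have [g gE gC] := f_cont; have [M Mbnd] := f_bnd (Dobj P f lam0).
pose W (v : 'rV[R]_m) := wshape P (v 0).
have det0 : 0 < \det (invmx (wshape P lam0)).
  exact/spd_det_gt0/spd_inv/Dfeasible_spd.
have M0 : 0 < M by apply: lt_le_trans det0 _; apply: Mbnd => //; exact/spd_inv/Dfeasible_spd.
pose c i := (1 - qform (invmx (P i)) (x i - y))^-1.
(* A compact set containing the sublevel set of [lam0]: the bound [M^-1 <= \det (W v)] is a closed
   substitute for invertibility of [W v]. *)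
pose K := [set v : 'rV[R]_m | forall i, `[0, c i]%classic (v 0 i)]
  `&` ([set v : 'rV[R]_m | forall tu : R * 'cV[R]_n, 0 <= Dform (v 0) tu.1 tu.2]
  `&` [set v : 'rV[R]_m | M^-1 <= \det (W v)]).
have contW a b : continuous (fun v : 'rV[R]_m => W v a b).
  rewrite (_ : (fun v : 'rV[R]_m => W v a b) =
    fun v : 'rV[R]_m => \sum_i v 0 i * invmx (P i) a b); last first.
    by apply/funext => v; rewrite summxE; apply: eq_bigr => i _; rewrite mxE.
  by apply: continuous_lincomb => i; exact: (@coord_continuous R 1 m 0 i).
have clD (tu : R * 'cV[R]_n) :
    closed [set v : 'rV[R]_m | 0 <= Dform (v 0) tu.1 tu.2].
  rewrite (_ : [set v : 'rV[R]_m | 0 <= Dform (v 0) tu.1 tu.2] =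
    [set v : 'rV[R]_m | - tu.1 ^+ 2 <= \sum_i v 0 i *
      (qform (invmx (P i)) (tu.1 *: x i + tu.2) - tu.1 ^+ 2)]); last first.
    by apply/funext => v; rewrite /mkset DformE -[in RHS]subr_ge0 opprK addrC.
  apply: closed_ge_continuous; apply: continuous_lincomb => i.
  exact: (@coord_continuous R 1 m 0 i).
have compK : compact K.
  apply: compact_closedI.
    apply: (@rV_compact R m (fun i => `[0, c i]%classic)) => i.
    exact: (@segment_compact R).
  apply: closedI; last by apply: closed_ge_continuous; exact: (continuous_det _ _ W).
  exact: (closed_forall _ _ _ clD).
have detK (v : 'rV[R]_m) : K v -> 0 < \det (W v).
  by move=> [_ [_]]; apply: lt_le_trans; rewrite invr_gt0.
have inK mu : Dfeasible x P mu -> Dobj P f mu <= Dobj P f lam0 -> K (\row_i mu i).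
  move=> hmu le; have [mu0 _ mD] := (DfeasibleE mu).1 hmu.
  have E : (\row_i mu i) 0 = mu by apply/funext => i; rewrite mxE.
  split; first by move=> i /=; rewrite E in_itv /= mu0 weight_le.
  split; first by move=> tu /=; rewrite E.
  rewrite /= /W E; have sW := Dfeasible_spd _ hmu.
  have := Mbnd _ (spd_inv _ sW) le; rewrite det_inv.
  by move=> ?; rewrite -[X in _ <= X]invrK lef_pV2 // posrE ?invr_gt0 // spd_det_gt0.
have Kfeas (v : 'rV[R]_m) : K v -> Dfeasible x P (v 0).
  move=> Kv; have [K1 [K2 _]] := Kv; apply/DfeasibleE; split.
  - by move=> i; have := K1 i; rewrite /= in_itv /= => /andP[].
  - by rewrite unitmxE unitfE gt_eqF // detK.
  - by move=> t u; exact: (K2 (t, u)).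
have [v] := @compact_EVT_min _ R (g \o W) K (ex_intro _ _ (inK _ h0 (lexx _))) compK
  (continuous_in_subspaceT (fun (v : 'rV[R]_m) Kv => gC _ W v contW (detK v (set_mem Kv)))).
rewrite inE => Kv vmin; exists (v 0); split; first exact: Kfeas.
have gW mu : Dfeasible x P mu -> Dobj P f mu = g (wshape P mu).
  by move=> hmu; rewrite /Dobj gE //; exact: Dfeasible_spd.
have vle mu : K (\row_i mu i) -> Dobj P f (v 0) <= Dobj P f mu.
  move=> Kmu; have := vmin _ (mem_set Kmu).
  have E : (\row_i mu i) 0 = mu by apply/funext => i; rewrite mxE.
  have := Kfeas _ Kmu; rewrite E => hmu.
  by rewrite /= /W E (gW _ (Kfeas _ Kv)) gW.
(* Feasible weights outside the sublevel set are worse than [lam0], which itself lies in [K]. *)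
move=> mu hmu; have [le|lt] := lerP (Dobj P f mu) (Dobj P f lam0).
  exact/vle/inK.
by apply: le_trans (ltW lt); apply/vle/inK.
Qed.

End Existence.

End Problems.

Theorem proposition3p3 (R : realType) (m n : nat)
    (x : 'I_m -> 'cV[R]_n) (P : 'I_m -> 'M[R]_n) (f : 'M[R]_n -> R)
    (hP : forall i, spd (P i))
    (hf : f = @trace_obj R n \/ f = @logdet_obj R n) :
  (* equivalence of (S) and (D): feasibility, optimal value, minimizers *)
  [/\ forall lam : 'I_m -> R,
        Dfeasible x P lam <->
        exists (P0 : 'M[R]_n) (xt0 : 'cV[R]_n), Sfeasible x P (P0, xt0, lam),
      ereal_inf [set (Sobj f s)%:E | s in Sfeasible x P] =
        ereal_inf [set (Dobj P f lam)%:E | lam in Dfeasible x P]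
    & forall (P0 : 'M[R]_n) (xt0 : 'cV[R]_n) (lam : 'I_m -> R),
        minimizer (Sfeasible x P) (@Sobj R m n f) (P0, xt0, lam) <->
        [/\ minimizer (Dfeasible x P) (Dobj P f) lam,
            P0 = invmx (wshape P lam) & xt0 = wcenter x P lam]]
  (* existence of an optimal solution of (S) *)
  /\ ((\bigcap_i ellipsoid (x i) (P i))° !=set0 ->
      Dfeasible x P !=set0 ->
      exists s : Svar R m n, minimizer (Sfeasible x P) (@Sobj R m n f) s)
  (* the optimal shape matrix and center *)
  /\ (forall (lams : 'I_m -> R) (P0 : 'M[R]_n) (x0 : 'cV[R]_n)
             (lam : 'I_m -> R),
        minimizer (Dfeasible x P) (Dobj P f) lams ->
        minimizer (Sfeasible x P) (@Sobj R m n f) (P0, invmx P0 *m x0, lam) ->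
        invmx P0 = \sum_(i < m) lams i *: invmx (P i) /\
        x0 = P0 *m \sum_(i < m) lams i *: (invmx (P i) *m x i)).

Proof.
have [f_incr f_mid] : loewner_increasing f /\ inv_midconvex f.
  by case: hf => ->; split; [exact: trace_increasing|exact: trace_midconvex
    |exact: logdet_increasing|exact: logdet_midconvex].
have [f_cont f_bnd] : inv_continuous n f /\ det_bounded n f.
  by case: hf => ->; split; [exact: trace_inv_continuous|exact: trace_det_bounded
    |exact: logdet_inv_continuous|exact: logdet_det_bounded].
split; [split|split].
- move=> lam; split=> [hD|[P0 [xt0 hS]]]; last exact: (Sfeasible_D x P hP _ _ _ hS).1.
  by do 2 eexists; exact: Dfeasible_S hD.
- exact: ereal_inf_SD.
- exact: minimizer_SD.
- move=> int0 D0; have [lam minD] := Dminimizer_exists x P hP f_cont f_bnd int0 D0.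
  exists (invmx (wshape P lam), wcenter x P lam, lam).
  exact/minimizer_SD.
- move=> lams P0 x0 lam minD minS.
  (* The weights [lam] of the (S) solution also minimize (D) but may differ from [lams]; uniqueness
     of shape and center bridges the two. *)
  have [minD' P0E x0E] := (minimizer_SD x P hP f_incr _ _ _).1 minS.
  have uP0 : P0 \in unitmx by case: minS => -[/spd_unit].
  rewrite -/(wshape P lams) -/(wcenter x P lams).
  rewrite (minimizer_wshape_uniq x P hP f_mid _ _ minD minD').
  rewrite (minimizer_wcenter_uniq x P hP f_incr f_mid _ _ minD minD').
  by split; [rewrite P0E invmxK|rewrite -x0E mulmxA mulmxV // mul1mx].
Qed.
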